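(* Let $M$ be a finitely generated $\mathbb{Z}^r$-graded $S$-module, let $\mathbf{v}\in\mathbb{Z}^r$ be a positive coarsening vector, and let $$s_{\mathbf{v}}:=\max\Big\{nc_{\mathbf{v}}-\sum_{i=1}^n\deg_{\mathbf{v}}(x_i),\ c_{\mathbf{v}}\Big\}.$$ If $F$ is a minimal generator of the $i$th syzygy module of $M^{[\mathbf{v}]}$ (over $S^{[\mathbf{v}]}$), then $$\deg F\le\operatorname{reg-num}_{\mathbf{v}}(M)+i s_{\mathbf{v}}+c_{\mathbf{v}}-1.$$
   Context: Let $k$ be a field and $S=k[x_1,\ldots,x_n]$, with a $\mathbb{Z}^r$-grading given by $\deg(x_i)=\mathbf{a}_i\in\mathbb{Z}^r$. Let $Q\subseteq\mathbb{Z}^r$ be the subsemigroup (containing $0$) generated by $\mathbf{a}_1,\ldots,\mathbf{a}_n$. $S$ is assumed positively multigraded: $\deg(x_i)\ne 0$ for all $i$ and $Q$ has no nonzero invertible elements. A vector $\mathbf{v}\in\mathbb{Z}^r$ is a positive coarsening vector if $\deg_{\mathbf{v}}(x_i):=\mathbf{a}_i\cdot\mathbf{v}>0$ for all $i$. For a $\mathbb{Z}^r$-graded module $M$, $M^{[\mathbf{v}]}$ denotes $M$ with the $\mathbb{Z}$-grading $(M^{[\mathbf{v}]})_m=\bigoplus_{\mathbf{a}\cdot\mathbf{v}=m}M_{\mathbf{a}}$; it is a graded module over $S^{[\mathbf{v}]}$. Put $\mathfrak{m}=\langle x_1,\ldots,x_n\rangle$ and $c_{\mathbf{v}}=\operatorname{lcm}(\deg_{\mathbf{v}}(x_1),\ldots,\deg_{\mathbf{v}}(x_n))$.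 Define $$\operatorname{reg}_{\mathbf{v}}(M)=\{p\in\mathbb{Z}\mid H^i_{\mathfrak{m}}(M^{[\mathbf{v}]})_q=0\ \text{for all } i\ge 0 \text{ and all } q\in p+(1-i)c_{\mathbf{v}}+\mathbb{N}c_{\mathbf{v}}\},$$ where $\mathbb{N}$ contains $0$, and $\operatorname{reg-num}_{\mathbf{v}}(M)=\inf\{p\in\operatorname{reg}_{\mathbf{v}}(M)\mid q\in\operatorname{reg}_{\mathbf{v}}(M)\text{ for all } q\ge p\}$. The minimal generators of the $i$th syzygy module ($i\ge 0$) correspond to the generators of the $i$th free module $F_i$ in the minimal graded free resolution $\cdots\to F_1\to F_0\to M^{[\mathbf{v}]}\to 0$; a generator of degree $m$ exists iff $\operatorname{Tor}_i^{S^{[\mathbf{v}]}}(M^{[\mathbf{v}]},k)_m\neq 0$. *)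

(* Defs.v *)
From HB Require Import structures.
From mathcomp Require Import all_boot all_order all_algebra.
From mathcomp Require Import zify mpoly.
From mathcomp Require Import boolp classical_sets constructive_ereal.

Set Implicit Arguments.
Unset Strict Implicit.
Unset Printing Implicit Defensive.

Import Order.TTheory GRing.Theory Num.Theory.
Local Open Scope quotient_scope.
Local Open Scope ring_scope.
Local Open Scope classical_set_scope.

(* The grading group G is int ^ r for S itself, and int for S^[v]. *)
Definition mon_weight n (G : zmodType) (w : 'I_n -> G) (m : 'X_{1..n}) : G :=
  \sum_(i < n) w i *+ m i.

Definition homogeneous n (k : fieldType) (G : zmodType) (w : 'I_n -> G)
    (b : G) (p : {mpoly k[n]}) : Prop :=
  forall m : 'X_{1..n}, m \in msupp p -> mon_weight w m = b.

(* comp a is the set of homogeneous elements of degree a of M. *)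
Record graded_module n (k : fieldType) (G : zmodType) (w : 'I_n -> G)
    (M : lmodType {mpoly k[n]}) (comp : G -> set M) : Prop := GradedModule {
  graded0 : forall a, comp a 0;
  gradedB : forall a x y, comp a x -> comp a y -> comp a (x - y);
  gradedZ : forall b p a x,
    homogeneous w b p -> comp a x -> comp (b + a) (p *: x);
  graded_span : forall x, exists (s : seq G) (f : G -> M),
    (forall a, comp a (f a)) /\ x = \sum_(a <- s) f a;
  graded_direct : forall (s : seq G) (f : G -> M), uniq s ->
    (forall a, comp a (f a)) -> \sum_(a <- s) f a = 0 ->
    forall a, a \in s -> f a = 0 }.

Definition finitely_generated (R : nzRingType) (M : lmodType R) : Prop :=
  exists (l : nat) (g : 'I_l -> M),
    forall x, exists c : 'I_l -> R, x = \sum_(i < l) c i *: g i.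

Definition dot r (a v : 'rV[int]_r) : int := \sum_(j < r) a 0 j * v 0 j.

Definition degree_semigroup n (G : zmodType) (w : 'I_n -> G) : set G :=
  [set q | exists e : 'I_n -> nat, q = \sum_(i < n) w i *+ e i].

Definition positively_multigraded n (G : zmodType) (w : 'I_n -> G) : Prop :=
  (forall i, w i != 0) /\
  (forall q, degree_semigroup w q -> degree_semigroup w (- q) -> q = 0).

Definition coarse_deg n r (a : 'I_n -> 'rV[int]_r) (v : 'rV[int]_r)
    (i : 'I_n) : int := dot (a i) v.

Definition positive_coarsening n r (a : 'I_n -> 'rV[int]_r)
    (v : 'rV[int]_r) : Prop := forall i, 0 < coarse_deg a v i.

(* The degree m part of M^[v]: the (internal) sum of the comp a, a . v = m. *)
Definition coarsen r (M : zmodType) (comp : 'rV[int]_r -> set M)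
    (v : 'rV[int]_r) (m : int) : set M :=
  [set x | exists (s : seq 'rV[int]_r) (f : 'rV[int]_r -> M),
    (forall a, a \in s -> dot a v = m /\ comp a (f a)) /\
    x = \sum_(a <- s) f a].

(* (x, t) stands for the fraction x / f^t. *)
Definition frac_rel (R : comNzRingType) (M : lmodType R) (f : R) :
    rel (M * nat) :=
  fun u v => `[< exists c, f ^+ (c + v.2) *: u.1 = f ^+ (c + u.2) *: v.1 >].

Section Localization.
Variables (R : comNzRingType) (M : lmodType R) (f : R).

Local Notation frel := (@frac_rel R M f).

Lemma frac_rel_refl : reflexive frel.
Proof. by move=> u; apply/asboolP; exists 0%N. Qed.

Lemma frac_rel_sym : ssrbool.symmetric frel.
Proof. by move=> u v; apply/asboolP/asboolP => -[c e]; exists c. Qed.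

Lemma frac_rel_trans : transitive frel.
Proof.
move=> v u z /asboolP[c e] /asboolP[d h]; apply/asboolP.
exists (c + d + v.2)%N.
have -> : (c + d + v.2 + z.2 = (d + z.2) + (c + v.2))%N by lia.
rewrite exprD -scalerA e scalerA -exprD.
have -> : (d + z.2 + (c + u.2) = (c + u.2) + (d + z.2))%N by lia.
rewrite exprD -scalerA h scalerA -exprD; congr (f ^+ _ *: _); lia.
Qed.

Canonical frac_equiv :=
  EquivRel frel frac_rel_refl frac_rel_sym frac_rel_trans.

Definition mloc := {eq_quot frac_equiv}.
HB.instance Definition _ := Choice.on mloc.
HB.instance Definition _ := Quotient.on mloc.

Definition frac (x : M) (t : nat) : mloc := \pi_mloc (x, t).

Lemma fracP x t y u : frac x t = frac y u <->
  exists c, f ^+ (c + u) *: x = f ^+ (c + t) *: y.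
Proof.
by split => [/eqmodP /asboolP | h]; last by apply/eqmodP/asboolP.
Qed.

Lemma frac_ind (P : mloc -> Prop) : (forall x t, P (frac x t)) -> forall u, P u.
Proof. by move=> H; elim/quotW => -[x t]; apply: H. Qed.

Lemma frac_repr (u : mloc) : frac (repr u).1 (repr u).2 = u.
Proof. by rewrite /frac -surjective_pairing reprK. Qed.

Definition mloc_add (u v : mloc) : mloc :=
  frac (f ^+ (repr v).2 *: (repr u).1 + f ^+ (repr u).2 *: (repr v).1)
    ((repr u).2 + (repr v).2).

Definition mloc_opp (u : mloc) : mloc := frac (- (repr u).1) (repr u).2.

Lemma mloc_addE x t y u :
  mloc_add (frac x t) (frac y u) = frac (f ^+ u *: x + f ^+ t *: y) (t + u).
Proof.
rewrite /mloc_add.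
have := frac_repr (frac x t); case: (repr _) => x' t' /= /fracP[c e].
have := frac_repr (frac y u); case: (repr _) => y' u' /= /fracP[d h].
apply/fracP; exists (c + d)%N.
rewrite !scalerDr !scalerA -!exprD; congr (_ + _).
  have -> : (c + d + (t + u) + u' = (d + u + u') + (c + t))%N by lia.
  rewrite exprD -scalerA e scalerA -exprD; congr (f ^+ _ *: _); lia.
have -> : (c + d + (t + u) + t' = (c + t + t') + (d + u))%N by lia.
rewrite exprD -scalerA h scalerA -exprD; congr (f ^+ _ *: _); lia.
Qed.

Lemma mloc_oppE x t : mloc_opp (frac x t) = frac (- x) t.
Proof.
rewrite /mloc_opp.
have := frac_repr (frac x t); case: (repr _) => x' t' /= /fracP[c e].
by apply/fracP; exists c; rewrite !scalerN e.
Qed.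

Lemma mloc_addA : associative mloc_add.
Proof.
elim/frac_ind => x t; elim/frac_ind => y u; elim/frac_ind => z v.
rewrite !mloc_addE; apply/fracP; exists 0%N.
rewrite !scalerDr !scalerA -!exprD addrA.
by congr (_ *: _ + _ *: _ + _ *: _); congr (f ^+ _); lia.
Qed.

Lemma mloc_addC : commutative mloc_add.
Proof.
elim/frac_ind => x t; elim/frac_ind => y u.
by rewrite !mloc_addE addrC addnC.
Qed.

Lemma mloc_add0 : left_id (frac 0 0) mloc_add.
Proof.
by elim/frac_ind => x t; rewrite mloc_addE scaler0 add0r expr0 scale1r add0n.
Qed.

Lemma mloc_addN : left_inverse (frac 0 0) mloc_opp mloc_add.
Proof.
elim/frac_ind => x t; rewrite mloc_oppE mloc_addE scalerN addNr.
by apply/fracP; exists 0%N; rewrite !scaler0.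
Qed.

HB.instance Definition _ :=
  GRing.isZmodule.Build mloc mloc_addA mloc_addC mloc_add0 mloc_addN.

End Localization.

(* The canonical map M_f -> M_h when h = f * g:  x / f^t |-> g^t x / h^t. *)
Definition mloc_map (R : comNzRingType) (M : lmodType R) (f g h : R)
    (u : mloc M f) : mloc M h :=
  frac h (g ^+ (repr u).2 *: (repr u).1) (repr u).2.

Lemma mloc_mapE (R : comNzRingType) (M : lmodType R) (f g h : R)
    (x : M) (t : nat) :
  h = f * g -> mloc_map g h (frac f x t) = frac h (g ^+ t *: x) t.
Proof.
move=> ->; rewrite /mloc_map.
have := frac_repr (frac f x t); case: (repr _) => x' t' /= /fracP[c e].
apply/fracP; exists c; rewrite !scalerA !exprMn.
have aux m l y : (f ^+ m * g ^+ m * g ^+ l) *: y = g ^+ (m + l) *: (f ^+ m *: y).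
  by rewrite scalerA exprD -mulrA mulrC.
rewrite !aux e; congr (g ^+ _ *: _); lia.
Qed.

Section LocalCohomology.
Variables (n : nat) (k : fieldType) (M : lmodType {mpoly k[n]}).
Variables (w : 'I_n -> int) (comp : int -> set M).

Definition xprod (I : {set 'I_n}) : {mpoly k[n]} := \prod_(i in I) 'X_i.

(* x / x_I^t has degree q when x has degree q + t * deg x_I. *)
Definition mloc_comp (I : {set 'I_n}) (q : int) : set (mloc M (xprod I)) :=
  [set u | exists x t,
    u = frac (xprod I) x t /\ comp (q + (\sum_(i in I) w i) *+ t) x].

(* Total Cech complex: the direct sum of the M_(x_I) over all subsets I;
   its part of cohomological degree i consists of the families supported on
   the subsets of cardinal i. *)
Definition cech := forall I : {set 'I_n}, mloc M (xprod I).

Definition cech_deg (i : nat) (u : cech) : Prop :=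
  forall I : {set 'I_n}, #|I| != i -> u I = 0.

Definition cech_comp (q : int) (u : cech) : Prop :=
  forall I, mloc_comp q (u I).

Definition cech_diff (u : cech) : cech := fun J =>
  \sum_(j in J)
    (mloc_map 'X_j (xprod J) (u (J :\ j)))
      *~ ((-1) ^+ #|[set l in J | (l < j)%N]|).

(* H^i(M)_q = 0: every i-cocycle of degree q is the coboundary of an
   (i-1)-cochain of degree q (which is 0 when i = 0). *)
Definition lc_vanishes (i : nat) (q : int) : Prop :=
  forall u : cech, cech_deg i u -> cech_comp q u ->
    (forall J, cech_diff u J = 0) ->
    exists b : cech,
      [/\ forall I : {set 'I_n}, #|I|.+1 != i -> b I = 0,
          cech_comp q b & forall J, u J = cech_diff b J].

End LocalCohomology.

Definition reg_set n (k : fieldType) (M : lmodType {mpoly k[n]})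
    (w : 'I_n -> int) (comp : int -> set M) (c : int) : set int :=
  [set p | forall (i : nat) (q : int),
    (exists l : nat, q = p + (1 - i%:Z) * c + l%:Z * c) ->
    lc_vanishes w comp i q].

Definition coarse_lcm n r (a : 'I_n -> 'rV[int]_r) (v : 'rV[int]_r) : int :=
  \big[lcmz/1]_(i < n) coarse_deg a v i.

Definition reg_v n r (k : fieldType) (a : 'I_n -> 'rV[int]_r)
    (M : lmodType {mpoly k[n]}) (comp : 'rV[int]_r -> set M)
    (v : 'rV[int]_r) : set int :=
  reg_set (coarse_deg a v) (coarsen comp v) (coarse_lcm a v).

(* The infimum is taken in the extended integers (+oo on the empty set). *)
Definition reg_num n r (k : fieldType) (a : 'I_n -> 'rV[int]_r)
    (M : lmodType {mpoly k[n]}) (comp : 'rV[int]_r -> set M)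
    (v : 'rV[int]_r) : \bar int :=
  infimum +oo%E [set p%:E | p in
    [set p | reg_v a comp v p /\ forall q, p <= q -> reg_v a comp v q]].

Definition s_v n r (a : 'I_n -> 'rV[int]_r) (v : 'rV[int]_r) : int :=
  Num.max (n%:Z * coarse_lcm a v - \sum_(i < n) coarse_deg a v i)
          (coarse_lcm a v).

(* F_i is the module of row vectors of length res_rank i, whose j-th basis
   vector has degree res_deg i j; res_diff i : F_(i+1) -> F_i acts on row
   vectors by u |-> u *m res_diff i, and res_aug gives the images in M of the
   basis of F_0. *)
Record resolution_data n (k : fieldType) (M : lmodType {mpoly k[n]}) :=
  ResolutionData {
    res_rank : nat -> nat;
    res_deg : forall i, 'I_(res_rank i) -> int;
    res_diff : forall i, 'M[{mpoly k[n]}]_(res_rank i.+1, res_rank i);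
    res_aug : 'I_(res_rank 0) -> M }.
Arguments res_rank {n k M} r i.
Arguments res_deg {n k M} r i j.
Arguments res_diff {n k M} r i.
Arguments res_aug {n k M} r j.

Definition aug_map n (k : fieldType) (M : lmodType {mpoly k[n]})
    (F : resolution_data M) (u : 'rV_(res_rank F 0)) : M :=
  \sum_j u 0 j *: res_aug F j.
Arguments aug_map {n k M} F u.

Definition irrelevant_ideal n (k : fieldType) : set {mpoly k[n]} :=
  [set p | exists c : 'I_n -> {mpoly k[n]}, p = \sum_(i < n) c i * 'X_i].

Record minimal_free_resolution n (k : fieldType) (w : 'I_n -> int)
    (M : lmodType {mpoly k[n]}) (comp : int -> set M) (F : resolution_data M) :
    Prop := MinimalFreeResolution {
  res_aug_graded : forall j, comp (res_deg F 0 j) (res_aug F j);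
  res_diff_graded : forall i j l,
    homogeneous w (res_deg F i.+1 j - res_deg F i l) (res_diff F i j l);
  res_aug_surj : forall x, exists u, x = aug_map F u;
  res_exact0 : forall u, aug_map F u = 0 <->
    exists y, u = y *m res_diff F 0;
  res_exact : forall i (u : 'rV_(res_rank F i.+1)),
    u *m res_diff F i = 0 <-> exists y, u = y *m res_diff F i.+1;
  res_minimal : forall i (u : 'rV_(res_rank F i.+1)) l,
    irrelevant_ideal ((u *m res_diff F i) 0 l) }.

(* Main.v *)
Require Import Defs.
From HB Require Import structures.
From mathcomp Require Import all_boot all_order all_algebra.
From mathcomp Require Import zify mpoly.
From mathcomp Require Import boolp classical_sets constructive_ereal.

Set Implicit Arguments.
Unset Strict Implicit.
Unset Printing Implicit Defensive.

Import Order.TTheory GRing.Theory Num.Theory.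
Local Open Scope ring_scope.
Local Open Scope classical_set_scope.

(** Let c be the lcm of the degrees w_i of the variables, and let p be such that
every integer q >= p lies in the regularity set.  Varying q turns the
definition into the vanishing of H^s(M)_d for all s and all d >= p + (1 - s) c.
A generator of F_i of degree m is a nonzero element of Tor_i(M, k)_m, and Tor
is the homology of the Koszul complex K(M) on the variables; the proof goes from
local cohomology to Koszul homology, and from there to the resolution.

From local cohomology to K(M).  In the double complex formed by K(M) and the
Cech complex, every Koszul complex K(M_(x_I)) with I nonempty is contractible,
since some variable acts invertibly on M_(x_I); only K(M) itself has
homology.  Walking down the double complex, [koszul_exact_of_lc_vanishes] kills
H_t(K(M))_m as soon as H^s(M) vanishes in degree m - w(S) for every s and
every set S of t + s variables, w(S) being the sum of their degrees: the part
of K_(t+s)(M) with basis vector e_S is a copy of M shifted by w(S).  As each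
w_i divides c, w(S) <= (t + s) c, so m >= p + c + t c is enough.

From K(M) to the resolution.  The Koszul complex of a free module is exact off
its constant terms ([kdiff_free_exact]), so Koszul classes can be shifted along
the resolution: [kdiff_syzygy_exact] turns the vanishing of H_i(K(M))_m into the
statement that every element of F_i of degree m is, modulo the image of F_(i+1),
a combination of elements of F_i with coefficients in the irrelevant ideal.  By
minimality that image has coefficients in the irrelevant ideal as well, so a
basis vector of degree m would have its coefficient 1 there
([res_deg_neq_of_lc_vanishes]).  Hence the generators of F_i have degree less
than p + c + i c, which gives the bound because c <= s_v.  This holds for each
p in the set of which the regularity number is the infimum, hence for the
infimum. *)

(** * Signed sums *)

Definition face_sign n (j : 'I_n) (J : {set 'I_n}) : int :=
  (-1) ^+ #|[set l in J | (l < j)%N]|.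

Lemma face_sign_sqr n (j : 'I_n) J : face_sign j J * face_sign j J = 1.
Proof. by rewrite /face_sign -exprMn mulrNN mulr1 expr1n. Qed.

(** Removing j and l from J in the two possible orders gives opposite signs:
removing the smaller one lowers the position of the larger by one. *)
Lemma face_sign_swap n (J : {set 'I_n}) (j l : 'I_n) :
  j \in J -> l \in J -> j != l ->
  face_sign j J * face_sign l (J :\ j) =
    - (face_sign l J * face_sign j (J :\ l)).
Proof.
suff aux (i h : 'I_n) : i \in J -> h \in J -> (i < h)%N ->
    face_sign i J * face_sign h (J :\ i) =
      - (face_sign h J * face_sign i (J :\ h)).
  move=> jJ lJ; rewrite neq_ltn => /orP[lt_jl | lt_lj]; first exact: aux.
  by rewrite (aux l j) // opprK.
move=> iJ hJ ih; rewrite /face_sign.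
have -> : [set l in J :\ h | (l < i)%N] = [set l in J | (l < i)%N].
  apply/setP => g; rewrite !inE; case: eqP => //= ->.
  by rewrite ltnNge (ltnW ih) andbF.
have <- : [set l in J | (l < h)%N] :\ i = [set l in J :\ i | (l < h)%N].
  by apply/setP => g; rewrite !inE andbA.
rewrite (cardsD1 i [set l in J | (l < h)%N]) inE iJ ih /= add1n exprS.
by rewrite mulrC -mulrA mulN1r opprK.
Qed.

Lemma face_sign_swap_del n (J : {set 'I_n}) (j l : 'I_n) :
  j \in J -> l \in J -> j != l ->
  face_sign j (J :\ l) * face_sign l (J :\ j) =
    - (face_sign j J * face_sign l J).
Proof.
move=> jJ lJ njl.
have := congr1 (fun z => face_sign j J * z) (face_sign_swap jJ lJ njl).
rewrite /= mulrA face_sign_sqr mul1r mulrN => ->.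
by rewrite mulrN mulrCA mulrA mulrACA face_sign_sqr mulr1 mulrC.
Qed.

Section SignedSums.
Variables (U V : zmodType) (f : U -> V).
Hypothesis fB : {morph f : x y / x - y}.

Lemma morphB_sum (I : finType) (P : pred I) (F : I -> U) (z : I -> int) :
  f (\sum_(i | P i) F i *~ z i) = \sum_(i | P i) f (F i) *~ z i.
Proof.
pose g := GRing.isZmodMorphism.Build U V f fB.
pose h : {additive U -> V} := HB.pack f g.
rewrite -[f]/(h : U -> V) raddf_sum; apply: eq_bigr => i _.
exact: raddfMz.
Qed.

Lemma morphB_0 : f 0 = 0.
Proof. by rewrite -(subrr 0) fB subrr. Qed.

Lemma morphB_D : {morph f : x y / x + y}.
Proof.
by move=> x y; rewrite -[y in LHS]opprK fB -[- y]add0r fB morphB_0 sub0r opprK.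
Qed.

Lemma morphB_Mz x z : f (x *~ z) = f x *~ z.
Proof.
have := morphB_sum (pred1 tt) (fun=> x) (fun=> z).
by rewrite !big_pred1_eq.
Qed.

End SignedSums.

(** The reason why d o d = 0 in both the Koszul and the Cech complex: the
terms for (j, l) and (l, j) cancel. *)
Lemma signed_double_sum_eq0 n (V : zmodType) (J : {set 'I_n})
    (G : 'I_n -> 'I_n -> V) :
  (forall j l, j \in J -> l \in J -> j != l -> G j l = G l j) ->
  \sum_(j in J) (\sum_(l in J :\ j) G j l *~ face_sign l (J :\ j))
      *~ face_sign j J = 0.
Proof.
move=> Gsym.
pose H j l := if [&& j \in J, l \in J & j != l]
  then G j l *~ (face_sign j J * face_sign l (J :\ j)) else 0.
have HN j l : H j l = - H l j.
  rewrite /H [l == j]eq_sym andbCA; case: ifP => [/and3P[lJ jJ njl]|_].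
    by rewrite face_sign_swap // mulrNz Gsym.
  by rewrite oppr0.
transitivity (\sum_j \sum_l H j l).
  rewrite [LHS]big_mkcond; apply: eq_bigr => j _.
  rewrite (big_mkcond (fun l => l \in J :\ j)) mulrz_suml /=.
  case: ifP => jJ; last by rewrite big1 // => l _; rewrite /H jJ.
  apply: eq_bigr => l _; rewrite /H jJ !inE andbC eq_sym.
  by case: ifP => _; rewrite ?mul0rz // -mulrzA mulrC.
transitivity (\sum_(j < n) \sum_(l < n | (l < j)%N) H j l
    + \sum_(j < n) \sum_(l < n | (j < l)%N) H j l).
  rewrite -big_split; apply: eq_bigr => j _ /=.
  rewrite (bigID (fun l : 'I_n => (l < j)%N)) /=; congr (_ + _).
  rewrite big_mkcond [RHS]big_mkcond; apply: eq_bigr => l _.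
  by case: ltngtP => // /val_inj ->; rewrite /H eqxx !andbF.
rewrite [X in _ + X](exchange_big_dep xpredT) //= -big_split big1 //= => j _.
by rewrite -big_split big1 //= => l _; rewrite [X in _ + X]HN subrr.
Qed.

(** * Koszul complexes and contracting homotopies *)

Section Koszul.
Variables (n : nat) (V : zmodType) (X : 'I_n -> V -> V).
Hypothesis XB : forall j, {morph X j : x y / x - y}.
Hypothesis XC : forall j l x, X j (X l x) = X l (X j x).

(** The Koszul complex of the operators X_j, the chain u having coefficient u T
on the exterior basis vector e_S for S the complement of T.  Indexing by
complements gives the differential the shape of the Cech differential, so that
the same signs serve both. *)
Definition kdiff (u : {set 'I_n} -> V) (T : {set 'I_n}) : V :=
  \sum_(j in T) X j (u (T :\ j)) *~ face_sign j T.

Lemma kdiffB u v T : kdiff (fun S => u S - v S) T = kdiff u T - kdiff v T.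
Proof.
by rewrite /kdiff -sumrB; apply: eq_bigr => j _; rewrite XB mulrzBl.
Qed.

Lemma kdiffD u v T : kdiff (fun S => u S + v S) T = kdiff u T + kdiff v T.
Proof.
rewrite /kdiff -big_split; apply: eq_bigr => j _.
by rewrite (morphB_D (XB j)) mulrzDl.
Qed.

Lemma kdiff_kdiff u T : kdiff (kdiff u) T = 0.
Proof.
rewrite -[RHS](@signed_double_sum_eq0 _ V T
  (fun j l => X j (X l (u (T :\ j :\ l))))); last first.
  by move=> j l _ _ _; rewrite XC finset.setDDl finset.setUC -finset.setDDl.
by apply: eq_bigr => j _; rewrite (morphB_sum (XB j)).
Qed.

Section Homotopy.
Variables (j : 'I_n) (q : V -> V).
Hypothesis qB : {morph q : x y / x - y}.
Hypothesis qX : cancel (X j) q.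
Hypothesis qXC : forall l x, l != j -> q (X l x) = X l (q x).

(** Division by x_j as a homotopy: wedging with e_j, that is removing j from
the complementary index, and applying the left inverse q of X_j. *)
Definition khom (u : {set 'I_n} -> V) (T : {set 'I_n}) : V :=
  if j \in T then 0 else q (u (j |: T)) *~ face_sign j (j |: T).

(** On cycles, d h differs from the identity only at the T containing j, and
there by 1 - X_j q.  When q is also a right inverse of X_j, h contracts the
complex; for polynomials, 1 - X_j q sets x_j = 0. *)
Lemma kdiff_khom u T : (forall S, kdiff u S = 0) ->
  kdiff (khom u) T = if j \in T then X j (q (u T)) else u T.
Proof.
move=> ucyc; case: ifP => jT.
  rewrite /kdiff (bigD1 j) //= big1 ?addr0 => [|l /andP[lT nlj]].
    rewrite /khom setD11 finset.setD1K // (morphB_Mz (XB j)).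
    by rewrite -mulrzA face_sign_sqr mulr1z.
  by rewrite /khom !inE jT eq_sym nlj /= (morphB_0 (XB l)) mul0rz.
set J := j |: T.
have jJ : j \in J by rewrite setU11.
have JT : J :\ j = T by rewrite setU1K ?jT.
have := congr1 q (ucyc J); rewrite (morphB_0 qB) (morphB_sum qB) (bigD1 j) //=.
rewrite JT qX => /eqP; rewrite addr_eq0 => /eqP uTE.
rewrite -[RHS]mulr1z -(face_sign_sqr j J) mulrzA uTE mulNrz mulrz_suml -sumrN.
rewrite /kdiff; apply: eq_big => [l|l lT].
  by rewrite !inE; case: (l =P j) => [->|_]; rewrite ?jT ?andbT.
have nlj : l != j by apply: contraFneq jT => <-.
have lJ : l \in J by rewrite !inE lT orbT.
have JlE : j |: (T :\ l) = J :\ l.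
  apply/setP => h; rewrite !inE; case: (h =P j) => [->|_] //=.
  by rewrite eq_sym nlj.
rewrite /khom !inE jT andbF JlE (morphB_Mz (XB l)) -!mulrzA qXC // -{1}JT.
by rewrite face_sign_swap_del 1?eq_sym // mulrC mulrNz
  [face_sign l J * _]mulrC.
Qed.

End Homotopy.
End Koszul.

Lemma kdiff_morph n (V W : zmodType) (X : 'I_n -> V -> V) (Y : 'I_n -> W -> W)
    (f : V -> W) (fB : {morph f : x y / x - y})
    (fX : forall j x, f (X j x) = Y j (f x)) (u : {set 'I_n} -> V) T :
  f (kdiff X u T) = kdiff Y (fun S => f (u S)) T.
Proof.
by rewrite /kdiff (morphB_sum fB); apply: eq_bigr => j _; rewrite fX.
Qed.

(** * Modules of fractions and the Cech complex *)

Local Notation frac := Defs.frac.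

Section Fractions.
Variables (R : comNzRingType) (M : lmodType R) (f : R).
Implicit Types (u v : mloc M f) (p g h : R).

Lemma frac_ext e (x : M) t : frac f (f ^+ e *: x) (t + e) = frac f x t.
Proof. by apply/fracP; exists 0%N; rewrite scalerA -exprD. Qed.

(** Any two fractions have a common denominator. *)
Lemma frac_ind2 (P : mloc M f -> mloc M f -> Prop) :
  (forall x y t, P (frac f x t) (frac f y t)) -> forall u v, P u v.
Proof.
move=> H; elim/frac_ind => x t; elim/frac_ind => y s.
by rewrite -(frac_ext s x) -(frac_ext t y) [(s + t)%N]addnC; apply: H.
Qed.

Lemma fracB (x y : M) t : frac f x t - frac f y t = frac f (x - y) t.
Proof.
transitivity (mloc_add (frac f x t) (mloc_opp (frac f y t))) => //.
by rewrite mloc_oppE mloc_addE -scalerDr frac_ext.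
Qed.

Lemma frac0 t : frac f (0 : M) t = 0.
Proof. by rewrite -(subrr (0 : M)) -fracB subrr. Qed.

(** Multiplication by p / f^e.  It covers at once the action of the variables
(e = 0) and, when f is a multiple of x_j, the action of 1 / x_j = (f / x_j) / f
(e = 1). *)
Definition mloc_act p e u : mloc M f :=
  frac f (p *: (repr u).1) ((repr u).2 + e).

Lemma mloc_actE p e x t : mloc_act p e (frac f x t) = frac f (p *: x) (t + e).
Proof.
rewrite /mloc_act.
have := frac_repr (frac f x t); case: (repr _) => x' t' /= /fracP[c E].
have shift m (y : M) :
    f ^+ (c + (m + e)) *: (p *: y) = (p * f ^+ e) *: (f ^+ (c + m) *: y).
  rewrite !scalerA addnA !exprD; congr (_ *: _).
  by rewrite mulrC -!mulrA; congr (p * _); rewrite mulrA mulrC.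
by apply/fracP; exists c; rewrite !shift E.
Qed.

Lemma mloc_actB p e : {morph mloc_act p e : u v / u - v}.
Proof.
by apply: frac_ind2 => x y t; rewrite fracB !mloc_actE scalerBr fracB.
Qed.

Lemma mloc_act_comp p e p' e' u :
  mloc_act p e (mloc_act p' e' u) = mloc_act (p * p') (e + e') u.
Proof.
by elim/frac_ind: u => x t; rewrite !mloc_actE scalerA -addnA [(e' + e)%N]addnC.
Qed.

Lemma mloc_act_id u : mloc_act f 1 u = u.
Proof.
by elim/frac_ind: u => x t; rewrite mloc_actE -[f in f *: x]expr1 frac_ext.
Qed.

End Fractions.

Lemma mloc_mapB (R : comNzRingType) (M : lmodType R) (f g h : R) :
  h = f * g -> {morph @mloc_map R M f g h : u v / u - v}.
Proof.
move=> hE; apply: frac_ind2 => x y t.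
by rewrite fracB !mloc_mapE // scalerBr fracB.
Qed.

Lemma mloc_map_act (R : comNzRingType) (M : lmodType R) (f g h p : R)
    (u : mloc M f) :
  h = f * g -> mloc_map g h (mloc_act p 0 u) = mloc_act p 0 (mloc_map g h u).
Proof.
move=> hE; elim/frac_ind: u => x t.
by rewrite mloc_actE !mloc_mapE // mloc_actE addn0 !scalerA mulrC.
Qed.

Lemma mloc_map_comp (R : comNzRingType) (M : lmodType R) (f g h g' h' : R)
    (u : mloc M f) :
  h = f * g -> h' = h * g' ->
  mloc_map g' h' (mloc_map g h u) = mloc_map (g * g') h' u.
Proof.
move=> hE h'E; elim/frac_ind: u => x t.
rewrite !mloc_mapE // ?scalerA -?exprMn 1?[g' * g]mulrC //.
by rewrite h'E hE mulrA.
Qed.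

Section Cech.
Variables (n : nat) (k : fieldType) (M : lmodType {mpoly k[n]}).
Implicit Types (I J T : {set 'I_n}) (u v : cech M).

Lemma xprod_setD1 J j : j \in J -> xprod k J = xprod k (J :\ j) * 'X_j.
Proof. by move=> jJ; rewrite /xprod (big_setD1 j) //= mulrC. Qed.

Lemma cech_diffE u J :
  cech_diff u J =
  \sum_(j in J) mloc_map 'X_j (xprod k J) (u (J :\ j)) *~ face_sign j J.
Proof. by []. Qed.

Lemma cech_diffB u v J :
  cech_diff (fun I => u I - v I) J = cech_diff u J - cech_diff v J.
Proof.
rewrite !cech_diffE -sumrB; apply: eq_bigr => j jJ.
by rewrite (mloc_mapB (xprod_setD1 jJ)) mulrzBl.
Qed.

(** Both ways of passing from J \ {j, l} to J amount to the single map
multiplying numerators by powers of x_j x_l, read off at the common source. *)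
Lemma cech_diff_diff u J : cech_diff (cech_diff u) J = 0.
Proof.
pose G I g := mloc_map g (xprod k J) (u I).
rewrite -[RHS](@signed_double_sum_eq0 _ _ J
  (fun j l => G (J :\ j :\ l) ('X_l * 'X_j))); last first.
  by move=> j l _ _ _; rewrite mulrC finset.setDDl finset.setUC -finset.setDDl.
rewrite cech_diffE; apply: eq_bigr => j jJ; congr (_ *~ _).
rewrite cech_diffE (morphB_sum (mloc_mapB (xprod_setD1 jJ))).
apply: eq_bigr => l lJ; congr (_ *~ _).
by rewrite /G (mloc_map_comp _ (xprod_setD1 lJ) (xprod_setD1 jJ)).
Qed.

Definition mloc_X I j : mloc M (xprod k I) -> mloc M (xprod k I) :=
  mloc_act 'X_j 0.

Lemma mloc_XB I j : {morph @mloc_X I j : u v / u - v}.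
Proof. exact: mloc_actB. Qed.

Lemma mloc_XC I j l (x : mloc M (xprod k I)) :
  mloc_X j (mloc_X l x) = mloc_X l (mloc_X j x).
Proof. by rewrite /mloc_X !mloc_act_comp mulrC. Qed.

Lemma cech_diff_kdiff (u : {set 'I_n} -> cech M) T J :
  cech_diff (fun I => kdiff (@mloc_X I) (u^~ I) T) J =
  kdiff (@mloc_X J) (fun S => cech_diff (u S) J) T.
Proof.
rewrite cech_diffE /kdiff.
under eq_bigr => j jJ.
  rewrite (morphB_sum (mloc_mapB (xprod_setD1 jJ))) mulrz_suml.
  over.
rewrite exchange_big; apply: eq_bigr => l lT.
rewrite cech_diffE (morphB_sum (@mloc_XB J l)) mulrz_suml /=.
apply: eq_bigr => j jJ; rewrite -!mulrzA mulrC; congr (_ *~ _).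
exact: mloc_map_act (xprod_setD1 jJ).
Qed.

End Cech.

(** * Gradings *)

(** The homogeneous components are only known to be closed under
subtraction and to contain 0; these lemmas extract what signed sums need. *)

Section Subgroups.
Variables (V : zmodType) (P : set V).
Hypothesis P0 : P 0.
Hypothesis PB : forall x y, P x -> P y -> P (x - y).

Lemma subgroupD x y : P x -> P y -> P (x + y).
Proof.
by move=> Px Py; rewrite -[y]opprK; apply: PB => //; rewrite -sub0r; apply: PB.
Qed.

Lemma subgroupMn x m : P x -> P (x *+ m).
Proof.
by move=> Px; elim: m => [|m IHm]; rewrite ?mulr0n // mulrS; apply: subgroupD.
Qed.

Lemma subgroupMz x z : P x -> P (x *~ z).
Proof.
move=> Px; case: z => m; first exact: subgroupMn.
by rewrite NegzE mulrNz -sub0r; apply: PB => //; apply: subgroupMn.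
Qed.

Lemma subgroup_sumMz (I : finType) (A : pred I) (F : I -> V) (z : I -> int) :
  (forall i, A i -> P (F i)) -> P (\sum_(i | A i) F i *~ z i).
Proof.
move=> PF; apply: big_ind => [//|x y|i Ai]; first exact: subgroupD.
exact/subgroupMz/PF.
Qed.

End Subgroups.

Section Grading.
Variables (n : nat) (w : 'I_n -> int).

Definition wt (I : {set 'I_n}) : int := \sum_(i in I) w i.

Lemma wt_setD1 (I : {set 'I_n}) j : j \in I -> wt I = w j + wt (I :\ j).
Proof. by move=> jI; rewrite /wt (big_setD1 j). Qed.

Lemma wt_compl_del (T : {set 'I_n}) j :
  j \in T -> wt (~: (T :\ j)) = w j + wt (~: T).
Proof.
move=> jT; rewrite (@wt_setD1 _ j) ?inE ?eqxx //; congr (_ + wt _).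
by apply/setP => i; rewrite !inE; case: (i =P j) => [->|_] //=; rewrite jT.
Qed.

Lemma card_compl_del (T : {set 'I_n}) j :
  j \in T -> #|~: (T :\ j)| = #|~: T|.+1.
Proof.
move=> jT; have := cardsC T; have := cardsC (T :\ j).
by rewrite (cardsD1 j T) jT; lia.
Qed.

Section KoszulDegree.
Variables (V : zmodType) (D : int -> set V) (X : 'I_n -> V -> V).
Hypothesis D0 : forall b, D b 0.
Hypothesis DB : forall b x y, D b x -> D b y -> D b (x - y).
Hypothesis DX : forall b j x, D b x -> D (b + w j) (X j x).
Hypothesis XB : forall j, {morph X j : x y / x - y}.

(** Homogeneous Koszul chains of degree m: e_S has the degree wt S, and S is
the complement of T. *)
Definition kdeg m (u : {set 'I_n} -> V) :=
  forall T : {set 'I_n}, D (m - wt (~: T)) (u T).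

(** The chains of homological degree t. *)
Definition ksupp t (u : {set 'I_n} -> V) :=
  forall T : {set 'I_n}, #|~: T| != t -> u T = 0.

Lemma kdiff_deg m u : kdeg m u -> kdeg m (kdiff X u).
Proof.
move=> uD T; apply: subgroup_sumMz => [||j jT]; [exact: D0|exact: DB|].
have -> : m - wt (~: T) = m - wt (~: (T :\ j)) + w j.
  by rewrite wt_compl_del //; lia.
exact/DX/uD.
Qed.

Lemma kdiff_supp t u : ksupp t.+1 u -> ksupp t (kdiff X u).
Proof.
move=> uS T tT; rewrite /kdiff big1 // => j jT.
by rewrite uS ?card_compl_del // (morphB_0 (XB j)) mul0rz.
Qed.

Variables (j : 'I_n) (q : V -> V).
Hypothesis Dq : forall b x, D b x -> D (b - w j) (q x).
Hypothesis qB : {morph q : x y / x - y}.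

Lemma khom_deg m u : kdeg m u -> kdeg m (khom j q u).
Proof.
move=> uD T; rewrite /khom; case: ifPn => jT; first exact: D0.
apply: (subgroupMz (D0 _) (DB (b := _))).
have := wt_compl_del (setU11 j T); rewrite setU1K // => ->.
by rewrite opprD addrCA addrC; apply/Dq/uD.
Qed.

Lemma khom_supp t u : ksupp t u -> ksupp t.+1 (khom j q u).
Proof.
move=> uS T tT; rewrite /khom; case: ifPn => // jT.
have := card_compl_del (setU11 j T); rewrite setU1K // => cT.
by rewrite uS ?(morphB_0 qB) ?mul0rz //; move: tT; rewrite cT.
Qed.

End KoszulDegree.
End Grading.

Section GradedFractions.
Variables (n : nat) (k : fieldType) (M : lmodType {mpoly k[n]}).
Variables (w : 'I_n -> int) (comp : int -> set M).
Hypothesis comp0 : forall b, comp b 0.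
Hypothesis compB : forall b x y, comp b x -> comp b y -> comp b (x - y).
Hypothesis compX : forall b j x, comp b x -> comp (b + w j) ('X_j *: x).
Implicit Types (I J T : {set 'I_n}).

Local Notation wt := (wt w).
Local Notation mcomp := (mloc_comp w comp).

Lemma comp_xprod I b x : comp b x -> comp (b + wt I) (xprod k I *: x).
Proof.
move=> bx; rewrite /wt /xprod.
elim/big_rec2: _ => [|j s p jI ps]; first by rewrite addr0 scale1r.
by rewrite addrCA addrC -scalerA; apply: compX.
Qed.

Lemma comp_xprodXn I t b x :
  comp b x -> comp (b + wt I *+ t) (xprod k I ^+ t *: x).
Proof.
move=> bx; elim: t => [|t IHt]; first by rewrite addr0 scale1r.
by rewrite mulrSr addrA exprS -scalerA; apply: comp_xprod.
Qed.

Lemma mcomp0 I b : @mcomp I b 0.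
Proof. by exists 0, 0%N; split; rewrite ?frac0. Qed.

Lemma mcompB I b u v : @mcomp I b u -> @mcomp I b v -> @mcomp I b (u - v).
Proof.
move=> [x [t [-> bx]]] [y [s [-> by_]]].
rewrite -(frac_ext _ s x) -(frac_ext _ t y) [(s + t)%N]addnC fracB.
do 2!eexists; split; first by [].
apply: compB; first by rewrite mulrnDr addrA; apply: comp_xprodXn.
by rewrite addnC mulrnDr addrA; apply: comp_xprodXn.
Qed.

Lemma mcompX I b j u : @mcomp I b u -> @mcomp I (b + w j) (mloc_X j u).
Proof.
move=> [x [t [-> bx]]]; exists ('X_j *: x), t.
by rewrite /mloc_X mloc_actE addn0; split=> //; rewrite addrAC; apply: compX.
Qed.

Lemma mcomp_map J j b (u : mloc M (xprod k (J :\ j))) : j \in J ->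
  mcomp b u -> @mcomp J b (mloc_map 'X_j (xprod k J) u).
Proof.
move=> jJ [x [t [-> bx]]]; rewrite (mloc_mapE _ _ (xprod_setD1 k jJ)).
exists ('X_j ^+ t *: x), t; split=> //.
rewrite -/(wt J) (wt_setD1 w jJ) mulrnDl.
have aux s : comp (b + (w j *+ s + wt (J :\ j) *+ t)) ('X_j ^+ s *: x).
  elim: s => [|s IHs]; first by rewrite mulr0n add0r scale1r.
  by rewrite mulrSr exprS -scalerA addrAC addrA; apply: compX.
exact: aux.
Qed.

(** Division by x_j in M_(x_I), meaningful when j belongs to I. *)
Definition mloc_divX I j : mloc M (xprod k I) -> mloc M (xprod k I) :=
  mloc_act (xprod k (I :\ j)) 1.

Lemma mloc_divXB I j : {morph @mloc_divX I j : u v / u - v}.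
Proof. exact: mloc_actB. Qed.

Lemma mloc_XK I j : j \in I -> cancel (@mloc_X _ _ M I j) (mloc_divX j).
Proof.
move=> jI u; rewrite /mloc_divX /mloc_X mloc_act_comp addn0 -xprod_setD1 //.
exact: mloc_act_id.
Qed.

Lemma mloc_XdivXC I j l (u : mloc M (xprod k I)) :
  mloc_divX j (mloc_X l u) = mloc_X l (mloc_divX j u).
Proof. by rewrite /mloc_divX /mloc_X !mloc_act_comp mulrC. Qed.

Lemma mcomp_divX I j b u : j \in I ->
  @mcomp I b u -> @mcomp I (b - w j) (mloc_divX j u).
Proof.
move=> jI [x [t [-> bx]]]; exists (xprod k (I :\ j) *: x), t.+1.
rewrite /mloc_divX mloc_actE addn1; split=> //.
have -> : b - w j + wt I *+ t.+1 = b + wt I *+ t + wt (I :\ j).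
  by rewrite mulrSr {2}(wt_setD1 w jI); lia.
exact: comp_xprod.
Qed.

(** For j in I the variable x_j acts invertibly on M_(x_I), so its inverse
provides a contracting homotopy, which respects the grading. *)
Lemma kdiff_frac_exact I m t (u : {set 'I_n} -> mloc M (xprod k I)) :
  I != finset.set0 -> kdeg w (@mcomp I) m u -> ksupp t u ->
  (forall T, kdiff (@mloc_X _ _ M I) u T = 0) ->
  exists y, [/\ kdeg w (@mcomp I) m y, ksupp t.+1 y &
    forall T, kdiff (@mloc_X _ _ M I) y T = u T].
Proof.
case/set0Pn => j jI uD uS ucyc; exists (khom j (mloc_divX j) u); split.
- apply: khom_deg uD; [exact: mcomp0|exact: mcompB|].
  by move=> b x; apply: mcomp_divX.
- exact: khom_supp (@mloc_divXB _ _) _ _ uS.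
move=> T; rewrite kdiff_khom //.
- by case: ifP => // _; rewrite -mloc_XdivXC mloc_XK.
- exact: mloc_XB.
- exact: mloc_divXB.
- exact: mloc_XK.
by move=> l x _; apply: mloc_XdivXC.
Qed.

End GradedFractions.

(** * The double complex of Koszul and Cech *)

Section Descent.
Variables (n : nat) (k : fieldType) (M : lmodType {mpoly k[n]}).
Variables (w : 'I_n -> int) (comp : int -> set M).
Hypothesis comp0 : forall b, comp b 0.
Hypothesis compB : forall b x y, comp b x -> comp b y -> comp b (x - y).
Hypothesis compX : forall b j x, comp b x -> comp (b + w j) ('X_j *: x).
Variables (m : int) (t : nat).
Hypothesis lc0 : forall (i : nat) (T : {set 'I_n}),
  #|~: T| = (t + i)%N -> lc_vanishes w comp i (m - wt w (~: T)).
Implicit Types (I J T : {set 'I_n}) (u : {set 'I_n} -> cech M).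

Local Notation dK u := (fun T I => kdiff (@mloc_X _ _ M I) (u^~ I) T).
Local Notation dC u := (fun T => cech_diff (u T)).

Definition bideg u := forall T, cech_comp w comp (m - wt w (~: T)) (u T).

Definition bisupp s q u := forall T I,
  (#|I| != q) || (#|~: T| != s) -> u T I = 0.

Lemma bideg_dK u : bideg u -> bideg (dK u).
Proof.
move=> uD T I; apply: (@kdiff_deg _ w _ (mloc_comp w comp (I := I))) => //.
- exact: mcomp0.
- exact: mcompB.
- by move=> b j x; apply: mcompX.
- by move=> S; apply: uD.
Qed.

Lemma bisupp_dK s q u : bisupp s.+1 q u -> bisupp s q (dK u).
Proof.
move=> uS T I /orP[qI|sT].
  rewrite /kdiff big1 // => j _.
  by rewrite uS ?qI // (morphB_0 (@mloc_XB _ _ _ _ _)) mul0rz.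
apply: (@kdiff_supp _ _ _ (@mloc_XB _ _ _ _) s) => // S sS.
by rewrite uS ?sS ?orbT.
Qed.

Lemma bideg_dC u : bideg u -> bideg (dC u).
Proof.
move=> uD T I; rewrite cech_diffE; apply: subgroup_sumMz.
- exact: mcomp0.
- exact: mcompB.
- by move=> j jI; apply: mcomp_map => //; apply: uD.
Qed.

Lemma bisupp_dC s q u : bisupp s q u -> bisupp s q.+1 (dC u).
Proof.
move=> uS T I hTI; rewrite cech_diffE big1 // => j jI.
rewrite uS; first by rewrite (morphB_0 (mloc_mapB (xprod_setD1 k jI))) mul0rz.
by move: hTI; rewrite (cardsD1 j I) jI.
Qed.

(** By descending induction on the Cech degree q, starting above n where the
Cech complex is zero.  The cochain dC u has positive Cech degree, so
[kdiff_frac_exact] writes it as dK z.  The induction hypothesis applies to z,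
whose image dC z is a Koszul cycle because dK dC z = dC dC u = 0, and gives
z - dK c = dC b.  Then dC (u - dK b) = dK z - dK (z - dK c) = 0, and the
vanishing of local cohomology makes u - dK b a Cech coboundary. *)
Lemma double_complex_descent q u :
  bisupp (t + q)%N q u -> bideg u -> (forall T I, dK (dC u) T I = 0) ->
  exists b c : {set 'I_n} -> cech M,
    [/\ forall T I, (#|I|.+1 != q) || (#|~: T| != (t + q)%N) -> b T I = 0,
        bideg b & forall T I, u T I - dK c T I = dC b T I].
Proof.
have [d] := ubnP (n.+1 - q); elim: d => // d IHd in q u *.
move=> lt_d uS uD ucyc.
have [lt_nq|le_qn] := ltnP n q.
  exists (fun T I => 0), (fun T I => 0); split => // [T I|T I].
    exact: mcomp0.
  rewrite uS; last first.
    by rewrite neq_ltn (leq_ltn_trans (max_card I)) // card_ord.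
  rewrite cech_diffE /kdiff !big1 ?subr0 // => j jI.
    by rewrite (morphB_0 (mloc_mapB (xprod_setD1 k jI))) mul0rz.
  by rewrite (morphB_0 (@mloc_XB _ _ _ _ _)) mul0rz.
have /fin_all_exists[y yP] : forall I,
    exists y : {set 'I_n} -> mloc M (xprod k I),
    [/\ kdeg w (mloc_comp w comp (I := I)) m y,
        forall T, (#|I| != q.+1) || (#|~: T| != (t + q).+1) -> y T = 0 &
        forall T, kdiff (@mloc_X _ _ M I) y T = dC u T I].
  move=> I; have [cI|qI] := eqVneq #|I| q.+1.
    have I0 : I != finset.set0 by rewrite -card_gt0 cI.
    have [|||y [yD yS yE]] := @kdiff_frac_exact _ _ M w comp comp0 compB compX
      I m (t + q)%N ((dC u)^~ I) I0.
    - by move=> T; apply: bideg_dC.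
    - by move=> T sT; apply: (bisupp_dC uS); rewrite sT orbT.
    - by move=> T; apply: ucyc.
    by exists y; split=> // T; apply: yS.
  exists (fun=> 0); split=> // [T|T]; first exact: mcomp0.
  rewrite (bisupp_dC uS) ?qI // /kdiff big1 // => j jI.
  by rewrite (morphB_0 (@mloc_XB _ _ _ _ _)) mul0rz.
pose z T I := y I T.
have zE T I : dK z T I = dC u T I by have [_ _ ->] := yP I.
have zD : bideg z by move=> T I; have [h _ _] := yP I; apply: h.
have zS : bisupp (t + q.+1)%N q.+1 z.
  by move=> T I; have [_ hS _] := yP I; rewrite addnS; apply: hS.
have zcyc T I : dK (dC z) T I = 0.
  rewrite -cech_diff_kdiff.
  have -> : (fun I => kdiff (@mloc_X _ _ M I) (z^~ I) T) = dC u T.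
    by apply: functional_extensionality_dep => J; apply: zE.
  exact: cech_diff_diff.
have [|b [c [bS bD zbc]]] := IHd _ z _ zS zD zcyc; first by lia.
pose v T I := u T I - dK b T I.
have vD : bideg v.
  by move=> T I; apply: mcompB => //; [exact: uD|exact: (bideg_dK bD)].
have vS : bisupp (t + q)%N q v.
  move=> T I h; rewrite /v uS // (@bisupp_dK (t + q)%N q) ?subrr // => S J.
  by rewrite -eqSS -addnS; apply: bS.
have vcyc T I : dC v T I = 0.
  rewrite cech_diffB cech_diff_kdiff -zE.
  have -> : (fun S => dC b S I) = (fun S => z S I - dK c S I).
    by apply: functional_extensionality_dep => S; rewrite zbc.
  rewrite (kdiffB (@mloc_XB _ _ _ _)) (kdiff_kdiff (@mloc_XB _ _ _ _)) ?subr0.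
    by rewrite subrr.
  exact: mloc_XC.
have /fin_all_exists[b' b'P] : forall T, exists b' : cech M,
    [/\ forall I, (#|I|.+1 != q) || (#|~: T| != (t + q)%N) -> b' I = 0,
        cech_comp w comp (m - wt w (~: T)) b' &
        forall I, v T I = cech_diff b' I].
  move=> T; have [cT|tT] := eqVneq #|~: T| (t + q)%N.
    have [|b' [b'S b'D vE]] := lc0 cT (u := v T) _ (vD T) (vcyc T).
      by move=> I qI; rewrite vS ?qI.
    by exists b'; split=> // I; rewrite orbF; apply: b'S.
  exists (fun=> 0); split=> // I; first exact: mcomp0.
  rewrite vS ?tT ?orbT // cech_diffE big1 // => j jI.
  by rewrite (morphB_0 (mloc_mapB (xprod_setD1 k jI))) mul0rz.
exists b', b; split=> [T I|T I|T I].
- by have [h _ _] := b'P T; apply: h.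
- by have [_ h _] := b'P T; apply: h.
by have [_ _ <-] := b'P T.
Qed.

(** The descent at Cech degree 0: M is the component of the Cech complex at
the empty set, and no Cech coboundaries exist in degree 0. *)
Lemma koszul_exact_of_lc_vanishes (x : {set 'I_n} -> M) :
  ksupp t x -> kdeg w comp m x ->
  (forall T, kdiff (fun j y => 'X_j *: y) x T = 0) ->
  exists y, forall T, kdiff (fun j y => 'X_j *: y) y T = x T.
Proof.
move=> xS xD xcyc.
have kdiff_frac I (y : {set 'I_n} -> M) T :
    kdiff (@mloc_X _ _ M I) (fun S => frac (xprod k I) (y S) 0) T =
    frac (xprod k I) (kdiff (fun j y => 'X_j *: y) y T) 0.
  apply/esym; apply: (kdiff_morph (f := fun y => frac (xprod k I) y 0)).
    by move=> y1 y2; rewrite fracB.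
  by move=> j z; rewrite /mloc_X mloc_actE.
pose u T I := frac (xprod k I) (if I == finset.set0 then x T else 0) 0.
have dKu T I : dK u T I = 0.
  rewrite /u kdiff_frac -[RHS](@frac0 _ M (xprod k I) 0).
  congr (frac _ _ _); case: eqP => _; first exact: xcyc.
  by rewrite /kdiff big1 // => j _; rewrite scaler0 mul0rz.
have [|||b [c [bS _ uE]]] := @double_complex_descent 0 u.
- move=> T I; rewrite addn0 cards_eq0 /u.
  case: eqP => /= _; last by rewrite frac0.
  by move=> tT; rewrite xS // frac0.
- move=> T I; rewrite /u; exists (if I == finset.set0 then x T else 0), 0%N.
  by rewrite addr0; split=> //; case: ifP => _; [apply: xD|apply: comp0].
- move=> T I; rewrite -cech_diff_kdiff cech_diffE big1 // => j jI.
  by rewrite dKu (morphB_0 (mloc_mapB (xprod_setD1 k jI))) mul0rz.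
(* the denominators at the empty set are powers of 1 *)
have x0 : xprod k (finset.set0 : {set 'I_n}) = 1 by rewrite /xprod big_set0.
have /choice[y yP] : forall T, exists y, c T finset.set0 = frac _ y 0.
  move=> T; rewrite -(frac_repr (c T finset.set0)).
  case: (repr _) => y s /=; exists y; rewrite -(frac_ext _ s y 0) add0n.
  by congr (frac _ _ s); rewrite x0 expr1n scale1r.
exists y => T.
have /eqP := uE T finset.set0.
rewrite cech_diffE big_set0 subr_eq0 eq_sym /u eqxx.
rewrite (_ : c^~ finset.set0 = fun S => frac _ (y S) 0); last first.
  by apply: functional_extensionality_dep => S; apply: yP.
rewrite kdiff_frac => /eqP/fracP[s].
by rewrite x0 !expr1n !scale1r.
Qed.

End Descent.

(** * Koszul complexes of free modules *)

Section DivX.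
Variables (n : nat) (k : fieldType).
Implicit Types (p q : {mpoly k[n]}) (m : 'X_{1..n}) (j l : 'I_n).

(** The quotient of p by x_j, dropping the monomials not divisible by x_j; it
plays here the role that the inverse of x_j plays for fractions. *)
Definition divX j p : {mpoly k[n]} :=
  \sum_(m <- msupp p | m j != 0%N) p@_m *: 'X_[m - U_(j)].

Lemma mcoeff_divX j p m : (divX j p)@_m = p@_(m + U_(j)).
Proof.
rewrite /divX raddf_sum /=.
under eq_bigr do rewrite mcoeffZ mcoeffX.
have eqU m' : m' j != 0%N -> (m' - U_(j) == m)%MM = (m' == m + U_(j))%MM.
  move=> m'j; have Um' : (U_(j) <= m')%MM by rewrite lep1mP.
  by apply/eqP/eqP => [<-|->]; rewrite ?submK ?addmK.
have Uj : (m + U_(j))%MM j != 0%N by rewrite mnmDE mnmE eqxx addn1.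
have [mp|mp] := boolP ((m + U_(j))%MM \in msupp p); last first.
  rewrite memN_msupp_eq0 // big_seq_cond big1 // => m' /andP[m'p m'j].
  rewrite eqU //; case: eqP => [E|_]; last by rewrite mulr0.
  by rewrite -E m'p in mp.
rewrite big_mkcond (bigD1_seq (m + U_(j))%MM) ?msupp_uniq //= Uj.
rewrite eqU // eqxx mulr1 big1 ?addr0 // => m' nm'.
by case: ifP => // m'j; rewrite eqU // (negPf nm') mulr0.
Qed.

Lemma mcoeff_mulX j p m :
  ('X_j * p)@_m = if m j != 0%N then p@_(m - U_(j)) else 0.
Proof.
rewrite mulrC; case: ifPn => mj.
  have Um : (U_(j) <= m)%MM by rewrite lep1mP.
  by rewrite -{1}(submK Um) addmC mcoeffMX.
apply: memN_msupp_eq0; rewrite (perm_mem (msuppMX _ _)).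
apply/mapP => -[m' _ mE]; move: mj.
by rewrite mE mnmDE mnmE eqxx.
Qed.

Lemma divXB j : {morph divX j : p q / p - q}.
Proof. by move=> p q; apply/mpolyP => m; rewrite !(mcoeff_divX, mcoeffB). Qed.

Lemma mulXK j p : divX j ('X_j * p) = p.
Proof.
apply/mpolyP => m; rewrite mcoeff_divX mcoeff_mulX addmK.
by rewrite mnmDE mnmE eqxx addn1.
Qed.

Lemma divX_mulX j l p : l != j -> divX j ('X_l * p) = 'X_l * divX j p.
Proof.
move=> nlj; apply/mpolyP => m; rewrite mcoeff_divX !mcoeff_mulX.
rewrite mnmDE mnmE [j == l]eq_sym (negPf nlj) addn0; case: ifP => // ml.
rewrite mcoeff_divX [(m - _ + _)%MM]addmC addmBA ?lep1mP //.
by rewrite [(U_(j) + m)%MM]addmC.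
Qed.

Section Degree.
Variables (G : zmodType) (w : 'I_n -> G).

Lemma homogeneousP b p : homogeneous w b p <->
  forall m, p@_m != 0 -> mon_weight w m = b.
Proof.
by split=> H m; [rewrite -mcoeff_msupp|rewrite mcoeff_msupp]; apply: H.
Qed.

Lemma homogeneous0 b : homogeneous w b (0 : {mpoly k[n]}).
Proof. by apply/homogeneousP => m; rewrite mcoeff0 eqxx. Qed.

Lemma homogeneousB b p q :
  homogeneous w b p -> homogeneous w b q -> homogeneous w b (p - q).
Proof.
move=> /homogeneousP pb /homogeneousP qb; apply/homogeneousP => m.
have [p0|p0 _] := eqVneq p@_m 0; last exact: pb.
by rewrite mcoeffB p0 sub0r oppr_eq0; apply: qb.
Qed.

Lemma mon_weightD m m' :
  mon_weight w (m + m') = mon_weight w m + mon_weight w m'.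
Proof.
by rewrite /mon_weight -big_split; apply: eq_bigr => i _; rewrite mnmDE mulrnDr.
Qed.

Lemma mon_weight1 j : mon_weight w U_(j) = w j.
Proof.
rewrite /mon_weight (bigD1 j) //= big1 => [|i nij].
  by rewrite mnmE eqxx addr0.
by rewrite mnmE [j == i]eq_sym (negPf nij).
Qed.

Lemma homogeneous_mulX b j p :
  homogeneous w b p -> homogeneous w (b + w j) ('X_j * p).
Proof.
move=> /homogeneousP pb; apply/homogeneousP => m; rewrite mcoeff_mulX.
case: ifP => [mj pm|_]; last by rewrite eqxx.
rewrite -(pb _ pm) -mon_weight1 -mon_weightD submK //.
by rewrite lep1mP.
Qed.

Lemma homogeneous_divX b j p :
  homogeneous w b p -> homogeneous w (b - w j) (divX j p).
Proof.
move=> /homogeneousP pb; apply/homogeneousP => m; rewrite mcoeff_divX => /pb <-.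
by rewrite mon_weightD mon_weight1 addrK.
Qed.

End Degree.
End DivX.

Section FreeModule.
Variables (n : nat) (k : fieldType) (r : nat).
Variables (w : 'I_n -> int) (d : 'I_r -> int).

Definition free_comp (b : int) : set 'rV[{mpoly k[n]}]_r :=
  [set v | forall l, homogeneous w (b - d l) (v 0 l)].

Local Notation X := (fun (j : 'I_n) (v : 'rV[{mpoly k[n]}]_r) => 'X_j *: v).

(** The homotopy built from [divX j] makes a cycle homologous to one that is
concentrated on the T containing j and whose coefficients do not involve x_j.
After all the variables have been used, only the constant terms at the full
set remain, and these have not changed since the start, where they are 0. *)
Lemma kdiff_free_exact m t (u : {set 'I_n} -> 'rV[{mpoly k[n]}]_r) :
  kdeg w free_comp m u -> ksupp t u -> (forall T, kdiff X u T = 0) ->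
  (forall l, (u finset.setT 0 l)@_0%MM = 0) ->
  exists y, [/\ kdeg w free_comp m y, ksupp t.+1 y &
    forall T, kdiff X y T = u T].
Proof.
move=> uD uS ucyc u0.
have D0 b : free_comp b 0 by move=> l; rewrite mxE; apply: homogeneous0.
have DB b x y : free_comp b x -> free_comp b y -> free_comp b (x - y).
  by move=> xb yb l; rewrite !mxE; apply: homogeneousB.
have DX b j x : free_comp b x -> free_comp (b + w j) ('X_j *: x).
  by move=> xb l; rewrite mxE addrAC; apply/homogeneous_mulX/xb.
have Dq j b x : free_comp b x -> free_comp (b - w j) (map_mx (divX j) x).
  by move=> xb l; rewrite mxE addrAC; apply/homogeneous_divX/xb.
have XB j : {morph X j : x y / x - y} by move=> x y; rewrite scalerBr.
have XC j l x : X j (X l x) = X l (X j x) by rewrite !scalerA mulrC.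
have qB j : {morph map_mx (divX j) : x y / (x : 'rV[{mpoly k[n]}]_r) - y}.
  by move=> x y; apply/rowP => l; rewrite !mxE divXB.
(* the invariant after the variables of a list have been treated *)
suff [y [yD yS y0 yE]] : exists y, [/\ kdeg w free_comp m y, ksupp t.+1 y,
    forall l, ((u finset.setT - kdiff X y finset.setT) 0 l)@_0%MM = 0 &
    forall T l e, ((u T - kdiff X y T) 0 l)@_e != 0 ->
      forall j, j \in enum 'I_n -> (j \in T) && (e j == 0%N)].
  exists y; split=> // T.
  apply/esym/eqP; rewrite -subr_eq0; apply/eqP/rowP => l.
  apply/mpolyP => e; rewrite [in RHS]mxE mcoeff0; apply/eqP/negP => /negP ne.
  have H j := yE T l e ne j (mem_enum _ j).
  have TT : T = finset.setT by apply/setP => j; rewrite inE; case/andP: (H j).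
  have e0 : e = 0%MM.
    by apply/mnmP => j; rewrite mnm0E; case/andP: (H j) => _ /eqP.
  by rewrite TT e0 y0 eqxx in ne.
elim: (enum _) => [|j s [y [yD yS y0 yE]]].
  exists (fun=> 0); have z T : kdiff X (fun=> 0) T = 0.
    by rewrite /kdiff big1 // => j _; rewrite scaler0 mul0rz.
  by split=> // l; rewrite z subr0.
pose v T := u T - kdiff X y T.
have vD : kdeg w free_comp m v.
  by move=> T; apply: (@DB _ _ _ (uD T)); exact: (kdiff_deg D0 DB DX yD).
have vS : ksupp t v.
  by move=> T tT; rewrite /v uS // (kdiff_supp XB yS) // subrr.
have vcyc T : kdiff X v T = 0.
  by rewrite (kdiffB XB) (kdiff_kdiff XB XC) ucyc subr0.
pose h := khom j (map_mx (divX j)) v.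
have hE T :
    kdiff X h T = if j \in T then 'X_j *: map_mx (divX j) (v T) else v T.
  rewrite /h (kdiff_khom XB (qB j)) // => [x|l x nlj]; apply/rowP => i.
    by rewrite !mxE mulXK.
  by rewrite !mxE divX_mulX.
have coefE T l e : ((v T - kdiff X h T) 0 l)@_e =
    if (j \in T) && (e j == 0%N) then (v T 0 l)@_e else 0.
  rewrite hE; case: ifP => jT /=; last by rewrite subrr mxE mcoeff0.
  rewrite !mxE mcoeffB mcoeff_mulX; case: eqP => ej /=; first by rewrite subr0.
  by rewrite mcoeff_divX submK ?subrr // lep1mP; apply/eqP.
have yhE T : u T - kdiff X (fun S => y S + h S) T = v T - kdiff X h T.
  by rewrite (kdiffD XB) opprD addrA.
exists (fun S => y S + h S); split.
- move=> T; apply: (subgroupD (D0 _) (@DB _) (yD T)).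
  exact: (khom_deg D0 DB (Dq j) vD).
- move=> T tT; rewrite yS // /h (khom_supp j (qB j) vS) //.
  by rewrite addr0.
- by move=> l; rewrite yhE coefE inE mnm0E eqxx; apply: y0.
move=> T l e; rewrite yhE coefE.
case: ifP => [jTe ne i|_]; last by rewrite eqxx.
by rewrite inE => /predU1P[-> //|]; apply: yE ne i.
Qed.

End FreeModule.

(** * Minimal free resolutions *)

Section Resolution.
Variables (n : nat) (k : fieldType) (M : lmodType {mpoly k[n]}).
Variables (w : 'I_n -> int) (comp : int -> set M).
Hypothesis comp0 : forall b, comp b 0.
Hypothesis compB : forall b x y, comp b x -> comp b y -> comp b (x - y).
Hypothesis compZ : forall b p q x,
  homogeneous w b p -> comp q x -> comp (b + q) (p *: x).
Variable F : resolution_data M.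
Hypothesis hF : minimal_free_resolution w comp F.

Local Notation X V := (fun (j : 'I_n) (x : V) => 'X_j *: x).
Local Notation free i := 'rV[{mpoly k[n]}]_(res_rank F i).

Lemma irrelevant_ideal_mcoeff0 (p : {mpoly k[n]}) :
  irrelevant_ideal p -> p@_0%MM = 0.
Proof.
case=> c ->; rewrite raddf_sum big1 //= => i _.
by rewrite mulrC mcoeff_mulX mnm0E.
Qed.

Lemma aug_mapB : {morph aug_map F : x y / x - y}.
Proof.
move=> x y; rewrite /aug_map -sumrB; apply: eq_bigr => j _.
by rewrite !mxE scalerBl.
Qed.

Lemma aug_mapZ p x : aug_map F (p *: x) = p *: aug_map F x.
Proof.
by rewrite /aug_map scaler_sumr; apply: eq_bigr => j _; rewrite mxE scalerA.
Qed.

Lemma aug_map_comp b x : free_comp w (res_deg F 0) b x -> comp b (aug_map F x).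
Proof.
move=> xb; apply: (big_ind (comp b)) => [|y z yb zb|l _]; first exact: comp0.
  exact: (subgroupD (comp0 b) (compB (b := b))).
rewrite -(subrK (res_deg F 0 l) b).
exact: compZ (xb l) (res_aug_graded hF l).
Qed.

Lemma res_diff_comp i b (x : free i.+1) :
  free_comp w (res_deg F i.+1) b x ->
  free_comp w (res_deg F i) b (x *m res_diff F i).
Proof.
move=> xb l; rewrite mxE; apply: (big_ind (homogeneous w _)).
- exact: homogeneous0.
- move=> p q; apply: (@subgroupD _ (homogeneous w _)) => [|p' q'].
    exact: homogeneous0.
  exact: homogeneousB.
move=> j _ e /msuppM_le/allpairsP[[e1 e2] [/= /xb e1b e2s ->]].
have e2b := res_diff_graded hF e2s.
by rewrite mon_weightD e1b e2b addrA subrK.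
Qed.

Variables (m : int) (i0 : nat).
Hypothesis lc0 : forall (q : nat) (T : {set 'I_n}),
  #|~: T| = (i0 + q)%N -> lc_vanishes w comp q (m - wt w (~: T)).

(** Exactness in Koszul degree t and internal degree m for the cokernel of
F_(i+1) -> F_i, stated with chains of F_i.  For i = 0 the cokernel is M.  In
the step, for chains of F_(i+1), the image of u in F_i is a cycle, hence some
d y with y of Koszul degree t + 1; y is a cycle modulo the image of F_(i+1), and
the induction hypothesis writes it as d x plus the image of a chain z of
F_(i+1).  Then u - d z is killed by the differential of F, hence comes from
F_(i+2). *)
Lemma kdiff_syzygy_exact i t (u : {set 'I_n} -> free i) :
  (i + t)%N = i0 -> kdeg w (free_comp w (res_deg F i)) m u -> ksupp t u ->
  (forall T, exists y, kdiff (X (free i)) u T = y *m res_diff F i) ->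
  exists z, forall T, exists y,
    u T - kdiff (X (free i)) z T = y *m res_diff F i.
Proof.
have fXB i' j : {morph X (free i') j : x y / x - y}.
  by move=> x y; rewrite scalerBr.
have fXC i' j l x :
    X (free i') j (X (free i') l x) = X (free i') l (X (free i') j x).
  by rewrite !scalerA mulrC.
elim: i => [|i IHi] in t u *; rewrite ?add0n => it uD uS ucyc.
  have augK x T : aug_map F (kdiff (X (free 0)) x T) =
      kdiff (X M) (fun S => aug_map F (x S)) T.
    by apply: kdiff_morph; [exact: aug_mapB|move=> j y; exact: aug_mapZ].
  have compX b j x : comp b x -> comp (b + w j) ('X_j *: x).
    move=> xb; rewrite addrC; apply: compZ => // e.
    by rewrite msuppX mem_seq1 => /eqP ->; rewrite mon_weight1.
  have [||||b bE] := koszul_exact_of_lc_vanishes comp0 compB compX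
    (m := m) (t := t) _ (x := fun T => aug_map F (u T)).
  - by move=> q T cT; apply: lc0; rewrite -it.
  - by move=> T tT; rewrite uS // (morphB_0 aug_mapB).
  - by move=> T; apply: aug_map_comp.
  - by move=> T; rewrite -augK; apply/(res_exact0 hF)/ucyc.
  have /choice[z zE] T : exists z, b T = aug_map F z := res_aug_surj hF (b T).
  exists z => T; apply/(res_exact0 hF); rewrite aug_mapB augK -bE.
  apply/eqP; rewrite subr_eq0; apply/eqP; congr kdiff.
  by apply: functional_extensionality_dep => S; rewrite zE.
have diffK x T : kdiff (X (free i.+1)) x T *m res_diff F i =
    kdiff (X (free i)) (fun S => x S *m res_diff F i) T.
  apply: (kdiff_morph (f := fun x => x *m res_diff F i)) => [x1 x2|j y].
    by rewrite mulmxBl.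
  by rewrite scalemxAl.
have [|||l|y [yD yS yE]] := @kdiff_free_exact n k _ w (res_deg F i) m t
    (fun T => u T *m res_diff F i).
- by move=> T; apply: res_diff_comp.
- by move=> T tT; rewrite uS // mul0mx.
- by move=> T; rewrite -diffK; apply/(res_exact hF)/ucyc.
- exact/irrelevant_ideal_mcoeff0/(res_minimal hF).
have [||x xE] := IHi _ y _ yD yS; first by rewrite addnS.
  by move=> T; exists (u T).
have /choice[z zE] := xE.
exists z => T; apply/(res_exact hF); rewrite mulmxBl diffK.
rewrite (_ : (fun S => _) = fun S => y S - kdiff (X (free i)) x S); last first.
  by apply: functional_extensionality_dep => S; rewrite zE.
by rewrite (kdiffB (fXB i)) (kdiff_kdiff (fXB i) (fXC i)) yE subr0 subrr.
Qed.

(** A basis vector is a Koszul chain of degree 0, living at the full set, and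
for trivial reasons a cycle. *)
Lemma res_deg_neq_of_lc_vanishes (j : 'I_(res_rank F i0)) : res_deg F i0 j <> m.
Proof.
move=> jm.
pose u (T : {set 'I_n}) : free i0 :=
  if T == finset.setT then delta_mx 0 j else 0.
have [||||z zE] := @kdiff_syzygy_exact i0 0 u.
- by rewrite addn0.
- move=> T l; rewrite /u; case: eqP => [->|_]; last first.
    by rewrite mxE; apply: homogeneous0.
  rewrite finset.setCT /wt big_set0 subr0 mxE eqxx /= -jm.
  case: eqP => [->|_]; last exact: homogeneous0.
  apply/homogeneousP => e; rewrite subrr mcoeff1.
  have [-> _|_] := eqVneq e 0%MM; last by rewrite eqxx.
  by rewrite /mon_weight big1 // => i _; rewrite mnm0E.
- move=> T; rewrite cards_eq0 /u -finset.setCT (inj_eq (@finset.setC_inj _)).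
  by case: eqP.
- move=> T; exists 0; rewrite mul0mx /kdiff big1 // => l lT.
  rewrite /u; case: eqP => [E|_]; last by rewrite scaler0 mul0rz.
  by have := finset.in_setT l; rewrite -E !inE eqxx.
have [y yE] := zE finset.setT.
have := irrelevant_ideal_mcoeff0 (res_minimal hF y j).
have z0 : (kdiff (X (free i0)) z finset.setT 0 j)@_0%MM = 0.
  apply: (subgroup_sumMz (P := [set x : free i0 | (x 0 j)@_0%MM = 0])) => /=.
  - by rewrite mxE mcoeff0.
  - by move=> x1 x2 h1 h2; rewrite !mxE mcoeffB h1 h2 subrr.
  - by move=> l _; rewrite mxE mcoeff_mulX mnm0E.
rewrite -yE /u eqxx [fun_of_matrix (_ - _) 0 j]mxE.
rewrite [fun_of_matrix (- _) 0 j]mxE mcoeffB z0 subr0.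
by rewrite mxE !eqxx mcoeff1 eqxx => /eqP; rewrite oner_eq0.
Qed.

End Resolution.

(** * Coarsened gradings and the degree bound *)

(** Lets two sums over different lists with repetitions be written over one
duplicate-free list. *)
Lemma sum_count_mem (I : eqType) (V : zmodType) (s s' : seq I) (f : I -> V) :
  uniq s' -> {subset s <= s'} ->
  \sum_(b <- s) f b = \sum_(b <- s') f b *+ count_mem b s.
Proof.
move=> s'U; elim: s => [|c s IHs] ss'.
  by rewrite big_nil big1 // => b _; rewrite mulr0n.
rewrite big_cons IHs => [|b bs]; last by apply: ss'; rewrite inE bs orbT.
under [RHS]eq_bigr do rewrite mulrnDr.
rewrite big_split; congr (_ + _) => /=.
rewrite (bigD1_seq c) ?ss' ?mem_head //= eqxx mulr1n big1 ?addr0 // => b nbc.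
by rewrite eq_sym (negPf nbc) mulr0n.
Qed.

Section Coarsening.
Variables (n r : nat) (k : fieldType) (a : 'I_n -> 'rV[int]_r).
Variables (M : lmodType {mpoly k[n]}) (comp : 'rV[int]_r -> set M).
Hypothesis hM : graded_module a comp.
Variable v : 'rV[int]_r.

Local Notation w := (coarse_deg a v).
Local Notation comp_v := (coarsen comp v).

Lemma dotB : {morph (fun b : 'rV[int]_r => dot b v) : x y / x - y}.
Proof.
by move=> x y; rewrite /dot -sumrB; apply: eq_bigr => j _; rewrite !mxE mulrBl.
Qed.

Lemma dot_mon_weight m : dot (mon_weight a m) v = mon_weight w m.
Proof. exact: (morphB_sum dotB xpredT a (fun i => (m i)%:Z)). Qed.

Lemma coarsen0 q : comp_v q 0.
Proof.
by exists [::], (fun=> 0); split=> [b //|]; rewrite big_nil.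
Qed.

Lemma coarsenB q x y : comp_v q x -> comp_v q y -> comp_v q (x - y).
Proof.
move=> [s [f [sf ->]]] [s' [f' [sf' ->]]].
set t := undup (s ++ s').
have tU : uniq t := undup_uniq _.
rewrite (@sum_count_mem _ _ s t) //; last first.
  by move=> b bs; rewrite mem_undup mem_cat bs.
rewrite (@sum_count_mem _ _ s' t) //; last first.
  by move=> b bs; rewrite mem_undup mem_cat bs orbT.
pose g b := f b *+ count_mem b s - f' b *+ count_mem b s'.
exists t, g; split; last by rewrite sumrB.
have compMn c z i : comp c z -> comp c (z *+ i).
  exact: (subgroupMn (graded0 hM c) (gradedB hM (a := c))).
move=> b; rewrite mem_undup mem_cat => bss'; split.
  by case/orP: bss' => [/sf[]|/sf'[]].
have cnt u h : (forall c, c \in u -> dot c v = q /\ comp c (h c)) ->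
    comp b (h b *+ count_mem b u).
  move=> uh; have [bu|bu] := boolP (b \in u); first by apply/compMn/(uh b bu).2.
  by rewrite (count_memPn bu); apply: graded0 hM b.
by apply: (gradedB hM); apply: cnt.
Qed.

Lemma coarsenZ_fine b p q x :
  homogeneous a b p -> comp_v q x -> comp_v (dot b v + q) (p *: x).
Proof.
move=> pb [s [f [sf ->]]].
exists [seq b + c | c <- s], (fun c => p *: f (c - b)); split.
  move=> _ /mapP[c cs ->]; have [cq fc] := sf c cs.
  rewrite addrAC subrr add0r (morphB_D dotB) cq; split=> //.
  exact: (gradedZ hM pb fc).
rewrite scaler_sumr big_map; apply: eq_bigr => c _.
by rewrite addrAC subrr add0r.
Qed.

Lemma coarsenZ b p q x :
  homogeneous w b p -> comp_v q x -> comp_v (b + q) (p *: x).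
Proof.
move=> pb xq; rewrite (mpolyE p) scaler_suml big_seq.
apply: big_ind => [|y z yq zq|m mp]; first exact: coarsen0.
  exact: (subgroupD (coarsen0 _) (@coarsenB _)).
rewrite -(pb m mp) -dot_mon_weight; apply: coarsenZ_fine => //.
apply/homogeneousP => e; rewrite mcoeffZ mcoeffX.
by case: (m =P e) => [->//|_]; rewrite mulr0 eqxx.
Qed.

Lemma coarse_lcm_gt0 : positive_coarsening a v -> 0 < coarse_lcm a v.
Proof.
move=> hv; apply: (big_ind (fun c => 0 < c)) => // x y x0 y0.
by rewrite lt_neqAle lcmz_ge0 eq_sym lcmz_neq0 !gt_eqF.
Qed.

Lemma coarse_deg_le_lcm i : positive_coarsening a v -> w i <= coarse_lcm a v.
Proof.
move=> hv; have : (w i %| coarse_lcm a v)%Z.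
  rewrite /coarse_lcm; have := mem_index_enum i.
  elim: (index_enum _) => // j s IHs; rewrite inE big_cons => /predU1P[->|/IHs].
    exact: dvdz_lcml.
  by move=> h; apply: dvdz_trans h (dvdz_lcmr _ _).
move=> /dvdzP[q cE]; have := coarse_lcm_gt0 hv; rewrite cE pmulr_lgt0 // => q0.
by rewrite ler_peMl ?(ltW (hv i)) //; lia.
Qed.

(** Any degree q beyond p + (1 - i) c is the starting point of the progression
attached to some p' >= p. *)
Lemma reg_v_lc_vanishes p i q :
  (forall p', p <= p' -> reg_v a comp v p') ->
  p + (1 - i%:Z) * coarse_lcm a v <= q -> lc_vanishes w comp_v i q.
Proof.
move=> hp le_q; apply: (hp (q - (1 - i%:Z) * coarse_lcm a v)); first by lia.
by exists 0%N; lia.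
Qed.

End Coarsening.

Theorem theorem3p7 (n r : nat) (k : fieldType) (a : 'I_n -> 'rV[int]_r)
    (ha : positively_multigraded a)
    (M : lmodType {mpoly k[n]}) (comp : 'rV[int]_r -> set M)
    (hM : graded_module a comp) (hfg : finitely_generated M)
    (v : 'rV[int]_r) (hv : positive_coarsening a v)
    (F : resolution_data M)
    (hF : minimal_free_resolution (coarse_deg a v) (coarsen comp v) F)
    (i : nat) (j : 'I_(res_rank F i)) :
  ((res_deg F i j)%:E <=
     reg_num a comp v + (i%:Z * s_v a v + coarse_lcm a v - 1)%:E)%E.
Proof.
set c := coarse_lcm a v; set C := (X in (_ + X%:E)%E).
have bound p : (forall p', p <= p' -> reg_v a comp v p') ->
    res_deg F i j <= p + C.
  move=> hp; suff : res_deg F i j < p + i%:Z * c + c.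
    have : i%:Z * c <= i%:Z * s_v a v.
      by rewrite ler_wpM2l // /s_v le_max lexx orbT.
    by rewrite /C; lia.
  rewrite ltNge; apply/negP => le_deg.
  apply: (res_deg_neq_of_lc_vanishes (coarsen0 comp v) (coarsenB hM (v := v))
    (coarsenZ hM (v := v)) hF (m := res_deg F i j)) (erefl _) => q T cT.
  apply: (reg_v_lc_vanishes hp).
  have : wt (coarse_deg a v) (~: T) <= c *+ #|~: T|.
    by rewrite -sumr_const; apply: ler_sum => l _; apply: coarse_deg_le_lcm.
  by rewrite cT -/c; nia.
(* the infimum is +oo unless it is a greatest lower bound *)
rewrite -leeBlDr // -EFinB /reg_num /infimum.
case: ifP => _; first exact: leey.
set S := [set _ | _ in _].
have [/(xgetPex +oo%E)[_ Imax]|noI] := pselect (exists x, infimums S x).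
  apply: Imax => _ [p [_ hp] <-].
  by rewrite lee_fin lerBlDr; apply: bound.
by rewrite xgetPN ?leey // => x Sx; apply: noI; exists x.
Qed.
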